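(* Let $K(n)=\sum_{i=1}^{n}1_A(i)$ be the arithmetic function counting the elements of a set $A$ of natural numbers that do not exceed $n$, regarded as an equally probable random variable with values $K(1),\dots,K(n)$ on the probability space $(\Omega_n,\mathcal{A}_n,\mathbb{P}_n)$ constructed on the initial interval $\{1,\dots,n\}$ of the natural series, and let $p_i=K(i)/i$ be the corresponding probabilities on the spaces $(\Omega_i,\mathcal{A}_i,\mathbb{P}_i)$, $i=1,\dots,n$. Then, for $K(i)=C\,i/\ln^k(i)$, where $C$ is a real number and $k$ is a natural number, the following asymptotic holds as $n\to\infty$: $$K(n)\sim\sum_{i=3}^{n}\frac{K(i)}{i}\sim\sum_{i=b+1}^{n}\frac{K(i)}{i}=\sum_{i=b+1}^{n}p_i ,$$ where $b$ is the (finite) number of discarded first terms of the sum $\sum_{i=1}^{n}K(i)/i$.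
   Context: $1_A$ is the indicator function of $A$; in the intended application $A$ is a set of prime objects (such as primes or twin primes), so that $K(n)$ is the number of such objects not exceeding $n$. For each natural number $n$, the probability space $(\Omega_n,\mathcal{A}_n,\mathbb{P}_n)$ has $\Omega_n=\{1,2,\dots,n\}$, $\mathcal{A}_n$ the family of all subsets of $\Omega_n$, and $\mathbb{P}_n(B)=\#\{m\in B\}/n$ for $B\subseteq\Omega_n$; an arithmetic function $f$ is regarded as the random variable $x_n(m)=f(m)$, $1\le m\le n$, on this space. Thus $p_i=K(i)/i=\mathbb{P}_i(A\cap\Omega_i)$. $\ln^k(i)$ denotes $(\ln i)^k$, and $f(n)\sim g(n)$ denotes asymptotic equality as $n\to\infty$ (the ratio tends to 1). *)

(* Defs.v *)
From mathcomp Require Import all_boot all_order all_algebra.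
From mathcomp Require Import all_classical all_reals all_analysis.
Import Order.TTheory GRing.Theory Num.Theory.
Import numFieldNormedType.Exports.

Set Implicit Arguments.
Unset Strict Implicit.
Unset Printing Implicit Defensive.

Local Open Scope classical_set_scope.
Local Open Scope ring_scope.

(* Omega_n = {1, ..., n} is encoded by 'I_n: the ordinal m stands for the
   natural number m.+1. The events are all the sets of type {set 'I_n}. *)
Definition Pr (R : realType) (n : nat) (B : {set 'I_n}) : R :=
  #|B|%:R / n%:R.

(* The event A `&` Omega_n *)
Definition trace (n : nat) (A : set nat) : {set 'I_n} :=
  [set m : 'I_n | m.+1 \in A]%SET.

Definition counting_fun (R : realType) (A : set nat) (n : nat) : R :=
  \sum_(1 <= i < n.+1) \1_A i.

(* For 0 < k this is meaningful only when 1 < n, because ln 1 = 0. *)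
Definition log_growth (R : realType) (C : R) (k n : nat) : R :=
  C * n%:R / (ln n%:R) ^+ k.

Definition asymp_eq (R : realType) (f g : nat -> R) : Prop :=
  f n / g n @[n --> \oo] --> (1 : R).

(* Main.v *)
Require Import Defs.
From mathcomp Require Import all_boot all_order all_algebra.
From mathcomp Require Import all_classical all_reals all_analysis.
From mathcomp Require Import ring.
Import Order.TTheory GRing.Theory Num.Theory.
Import numFieldNormedType.Exports.

Local Open Scope classical_set_scope.
Local Open Scope ring_scope.

(* The key fact is that u_i (ln i)^k --> l implies
   (ln n)^k / n * \sum_(m < i <= n) u_i --> l, by induction on k from Cesaro's
   theorem. In the step, with A(n) the partial sums of u, Abel summation gives
     ln(n+1) A(n) = \sum u_i ln i + \sum A(j) (ln(j+1) - ln j).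
   Since u_i (ln i)^k --> 0, the induction hypothesis gives
   A(j) (ln j)^k / j --> 0; as 0 <= j (ln(j+1) - ln j) <= 1, it then applies
   again and makes the second sum negligible, while the first one has the limit
   l by the induction hypothesis. *)

Lemma eq_near_cvg (R : realType) (f g : nat -> R) (l : R) :
  (\forall n \near \oo, f n = g n) ->
  f n @[n --> \oo] --> l -> g n @[n --> \oo] --> l.
Proof. by move=> fg; apply: cvg_trans; apply: near_eq_cvg. Qed.

Lemma cvg0_mul_bounded (R : realType) (f g : nat -> R) :
  (forall n, `|g n| <= 1) -> f n @[n --> \oo] --> (0 : R) ->
  f n * g n @[n --> \oo] --> (0 : R).
Proof.
move=> g1 /cvgr0Pnorm_le f0; apply/cvgr0Pnorm_le => e e0.
apply: filterS (f0 e e0) => n; apply: le_trans.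
by rewrite normrM ler_piMr.
Qed.

Lemma cvg_invr_ln_nat (R : realType) :
  (ln n%:R)^-1 @[n --> \oo] --> (0 : R).
Proof.
apply/gtr0_cvgV0.
  near=> n; apply: ln_gt0; rewrite ltr1n; near: n; exact: nbhs_infty_gt.
apply/cvgryPgt => M; near=> n.
rewrite -[M]expRK ltr_ln ?posrE ?expR_gt0//.
  by near: n; exact: nbhs_infty_gtr.
by rewrite ltr0n; near: n; exact: nbhs_infty_gt.
Unshelve. all: by end_near. Qed.

Lemma ln_nat_neq0 (R : realType) : \forall n \near \oo, ln n%:R != 0 :> R.
Proof.
near=> n; rewrite gt_eqF//; apply: ln_gt0; rewrite ltr1n.
by near: n; exact: nbhs_infty_gt.
Unshelve. all: by end_near. Qed.

(* At n = 0 this uses ln 0 = 0. *)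
Lemma ln_nat_gap (R : realType) (n : nat) :
  0 <= ln n.+1%:R - ln n%:R :> R /\ n%:R * (ln n.+1%:R - ln n%:R) <= 1 :> R.
Proof.
case: n => [|n]; first by rewrite ln1 ln0// subrr mul0r.
have n0 : 0 < n.+1%:R :> R by rewrite ltr0n.
split; first by rewrite subr_ge0 ler_ln ?posrE// ler_nat.
(* This becomes ln (1 + x) <= x at x = 1 / [n.+1]. *)
rewrite -ln_div ?posrE// -ler_pdivlMl// mulr1.
rewrite -[n.+2]addn1 natrD mulrDl divff ?gt_eqF// mul1r.
by apply: le_ln1Dx; rewrite (lt_trans (ltrN10 _))// invr_gt0.
Qed.

(** With ln (n + 1) on the left, no boundary term is left over and passing from n to n + 1 adds one
    term to each sum. *)
Lemma abel_sum_ln (R : realType) (u : nat -> R) (m n : nat) :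
  ln n.+1%:R * (\sum_(m.+1 <= i < n.+1) u i) =
  \sum_(m.+1 <= i < n.+1) u i * ln i%:R +
  \sum_(m.+1 <= j < n.+1)
    (\sum_(m.+1 <= i < j.+1) u i) * (ln j.+1%:R - ln j%:R).
Proof.
elim: n => [|n IH]; first by rewrite !big_geq// mulr0 addr0.
have [mn|nm] := leqP m n; last by rewrite !big_geq// mulr0 addr0.
rewrite [in RHS]big_nat_recr//= [X in _ = _ + X]big_nat_recr//=.
rewrite addrACA -IH [in X in _ = _ + X]big_nat_recr//= big_nat_recr//=.
ring.
Qed.

Lemma cesaro_nat (R : realType) (u : nat -> R) (m : nat) (l : R) :
  u n @[n --> \oo] --> l ->
  n%:R^-1 * (\sum_(m.+1 <= i < n.+1) u i) @[n --> \oo] --> l.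
Proof.
(* Cesaro means start at index 0: [v] shifts [u] by one and vanishes below [m], so that [series v n]
   is the sum in the goal once m <= n. *)
move=> ul; pose v i := if (m <= i)%N then u i.+1 else 0.
have : v n @[n --> \oo] --> l.
  move: ul; rewrite -(cvg_shiftS u); apply: eq_near_cvg; near=> n; rewrite /v ifT//.
  by near: n; exact: nbhs_infty_ge.
move/cesaro; rewrite /arithmetic_mean/=.
rewrite (cvg_shiftS (fun n => n%:R^-1 * series v n)).
apply: eq_near_cvg; near=> n.
congr (_ * _); rewrite seriesEnat/= big_add1/= /v -big_mkcond/=.
rewrite (@big_cat_nat _ _ _ m)//=; last by near: n; exact: nbhs_infty_ge.
rewrite big_nat_cond big1 ?add0r; last first.
  by move=> i /andP[/andP[_ im]]; rewrite leqNgt im.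
by rewrite big_nat_cond [RHS]big_nat_cond; apply: eq_bigl => i; case: (m <= i)%N.
Unshelve. all: by end_near. Qed.

Lemma cvg_sum_ln_exp (R : realType) (k m : nat) (u : nat -> R) (l : R) :
  u n * ln n%:R ^+ k @[n --> \oo] --> l ->
  ln n%:R ^+ k / n%:R * (\sum_(m.+1 <= i < n.+1) u i) @[n --> \oo] --> l.
Proof.
(* [u] and [l] stay general, since the induction hypothesis serves three different sequences. *)
elim: k u l => [|k IH] u l ul.
  under eq_fun do rewrite expr0 mul1r.
  by apply: cesaro_nat; move: ul; under eq_fun do rewrite expr0 mulr1.
pose A n := \sum_(m.+1 <= i < n.+1) u i.
pose gap n : R := ln n.+1%:R - ln n%:R.
have A0 : ln n%:R ^+ k / n%:R * A n @[n --> \oo] --> (0 : R).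
  apply: (IH u 0); have /(_ _) := cvgM ul (cvg_invr_ln_nat R); rewrite mulr0.
  apply: eq_near_cvg; near=> n.
  have ln0 : ln n%:R != 0 :> R by near: n; exact: ln_nat_neq0.
  by rewrite /= exprSr mulrA mulfK.
have gap1 n : `|n%:R * gap n| <= 1.
  by have [? ?] := ln_nat_gap R n; rewrite ger0_norm// mulr_ge0.
have gap1' n : `|gap n| <= 1.
  have [g0 g1] := ln_nat_gap R n; rewrite ger0_norm//.
  case: n g0 g1 => [|n] g0; first by rewrite /gap ln1 ln0// subrr.
  by apply: le_trans; rewrite ler_peMl// ler1n.
have B0 : ln n%:R ^+ k / n%:R * (\sum_(m.+1 <= j < n.+1) A j * gap j)
    @[n --> \oo] --> (0 : R).
  (* The factor j is moved from the denominator to the gap: A(j) gap(j) (ln j)^k = ((ln j)^k / j *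
     A(j)) * (j gap(j)). *)
  apply: (IH (fun j => A j * gap j) 0); have := cvg0_mul_bounded _ _ _ gap1 A0.
  apply: eq_near_cvg; near=> n.
  have n0 : n%:R != 0 :> R.
    by rewrite pnatr_eq0 -lt0n; near: n; exact: nbhs_infty_gt.
  by field.
have U : ln n%:R ^+ k / n%:R * (\sum_(m.+1 <= i < n.+1) u i * ln i%:R)
    @[n --> \oo] --> l.
  apply: (IH (fun i => u i * ln i%:R) l); move: ul; apply: eq_near_cvg; near=> n.
  by rewrite exprS mulrA.
have /(_ _) UB := cvgD U B0.
(* Abel summation yields the factor ln (n + 1) where ln n is wanted; the difference contributes (ln
   n)^k / n * A(n) gap(n), which tends to 0. *)
have /(_ _) := cvgB UB (cvg0_mul_bounded _ _ _ gap1' A0).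
rewrite addr0 subr0; apply: eq_near_cvg; near=> n.
rewrite !fctE -mulrDr -abel_sum_ln -/(A n) /gap exprS.
ring.
Unshelve. all: by end_near. Qed.

Lemma asymp_eq_of_cvg_mul (R : realType) (w f g : nat -> R) (C : R) :
  C != 0 -> (\forall n \near \oo, w n != 0) ->
  w n * f n @[n --> \oo] --> C -> w n * g n @[n --> \oo] --> C ->
  asymp_eq f g.
Proof.
move=> C0 w0 fC gC; have /(_ _) gV := cvgV C0 gC.
have /(_ _) := cvgM fC gV; rewrite divff//.
apply: eq_near_cvg; apply: filterS w0 => n w0.
by rewrite /= invfM mulrACA divff// mul1r.
Qed.

(** For u_i = K(i) / i the hypothesis says u_i (ln i)^k --> C, so [K] and its sums from any starting
    index have the same limit [C] under the weight (ln n)^k / n. *)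
Lemma asymp_eq_sum_div (R : realType) (C : R) (k b : nat) (K : nat -> R) :
  C != 0 -> ln n%:R ^+ k / n%:R * K n @[n --> \oo] --> C ->
  asymp_eq K (fun n : nat => \sum_(3 <= i < n.+1) K i / i%:R) /\
  asymp_eq (fun n : nat => \sum_(3 <= i < n.+1) K i / i%:R)
           (fun n : nat => \sum_(b.+1 <= i < n.+1) K i / i%:R).
Proof.
move=> C0 KC; pose w n : R := ln n%:R ^+ k / n%:R.
have w0 : \forall n \near \oo, w n != 0.
  near=> n; rewrite mulf_neq0// ?expf_neq0 ?invr_eq0//.
    by near: n; exact: ln_nat_neq0.
  by rewrite pnatr_eq0 -lt0n; near: n; exact: nbhs_infty_gt.
have S m : w n * (\sum_(m.+1 <= i < n.+1) K i / i%:R) @[n --> \oo] --> C.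
  apply: cvg_sum_ln_exp; move: KC; apply: eq_near_cvg; near=> n.
  by rewrite mulrC mulrA mulrAC.
by split; apply: (asymp_eq_of_cvg_mul _ w _ _ _ C0 w0) => //; exact: S.
Unshelve. all: by end_near. Qed.

Lemma card_trace (R : realType) (A : set nat) (n : nat) :
  #|trace n A|%:R = counting_fun R A n.
Proof.
rewrite /counting_fun big_add1 big_mkord -sum1_card natr_sum big_mkcond/=.
by apply: eq_bigr => i _; rewrite inE indicE; case: (_ \in A).
Qed.

(** The growth law is read asymptotically for a counting function, whose values are integers, and
    exactly from i = 2 on for a real sequence. Both readings give (ln n)^k / n * K(n) --> C. *)
Theorem corollary3 (R : realType) (C : R) (k b : nat) (hC : C != 0) :
  (forall A : set nat,
    asymp_eq (counting_fun R A) (log_growth C k) ->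
    [/\ asymp_eq (counting_fun R A)
          (fun n : nat => \sum_(3 <= i < n.+1) counting_fun R A i / i%:R),
        asymp_eq
          (fun n : nat => \sum_(3 <= i < n.+1) counting_fun R A i / i%:R)
          (fun n : nat => \sum_(b.+1 <= i < n.+1) counting_fun R A i / i%:R) &
        forall n : nat,
          \sum_(b.+1 <= i < n.+1) counting_fun R A i / i%:R =
          \sum_(b.+1 <= i < n.+1) Pr R (trace i A)])
  /\
  (forall K : nat -> R,
    (forall i : nat, (1 < i)%N -> K i = log_growth C k i) ->
    asymp_eq K (fun n : nat => \sum_(3 <= i < n.+1) K i / i%:R) /\
    asymp_eq (fun n : nat => \sum_(3 <= i < n.+1) K i / i%:R)
             (fun n : nat => \sum_(b.+1 <= i < n.+1) K i / i%:R)).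
Proof.
split=> [A AC|K KC].
  have [] := asymp_eq_sum_div R C k b (counting_fun R A) hC.
    have /(_ _) CC := @cvg_cst R C nat \oo.
    have /(_ _) := cvgM AC CC; rewrite mul1r; apply: eq_near_cvg.
    near=> n; rewrite /= /log_growth !invfM invrK; field.
    by rewrite hC andbT pnatr_eq0 -lt0n; near: n; exact: nbhs_infty_gt.
  split=> // n; apply: eq_bigr => i _.
  by rewrite /Pr card_trace.
(* The weighted sequence equals [C] as soon as 1 < n, where ln n is nonzero. *)
apply: (asymp_eq_sum_div _ C k) => //; apply: cvg_near_cst; near=> n.
have n1 : (1 < n)%N by near: n; exact: nbhs_infty_gt.
have n0 : n%:R != 0 :> R by rewrite pnatr_eq0 -lt0n ltnW.
have ln0 : ln n%:R ^+ k != 0 :> R by rewrite expf_neq0// gt_eqF// ln_gt0// ltr1n.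
by rewrite KC// /log_growth; field; rewrite ?n0 ?ln0 ?andbT.
Unshelve. all: by end_near. Qed.
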